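(* Let $G$ be a $k$-regular graph with $n$ vertices, and let $L$ be a list assignment giving each vertex $v$ of $G$ a list $L(v)$ of exactly $k$ colors. If $G$ has at least one proper $L$-list coloring, then $G$ has at least $n\left(\frac{k}{4}-1\right)+1$ proper $L$-list colorings.
   Context: Graphs are finite and simple. A proper $L$-list coloring of $G$ is a map $c$ on $V(G)$ with $c(v)\in L(v)$ for all $v\in V(G)$ and $c(u)\ne c(v)$ for every edge $uv\in E(G)$. *)

(* Defs.v *)
From mathcomp Require Import all_boot all_order all_algebra finmap.

Set Implicit Arguments.
Unset Strict Implicit.
Unset Printing Implicit Defensive.

Definition simple_graph (V : finType) (e : rel V) : Prop :=
  symmetric e /\ irreflexive e.

Definition regular (V : finType) (e : rel V) (k : nat) : Prop :=
  forall v : V, #|[set u | e v u]| = k.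

(* The colors come from an arbitrary, possibly infinite, choiceType.  A map c
   with c v \in L v for all v is an element of the finite dependent product
   of the lists, so that the colorings form a finite set; \val (c v) : C is
   the color of v. *)
Definition list_colorings (V : finType) (C : choiceType) (e : rel V)
    (L : V -> {fset C}) : {set {dffun forall v : V, L v}} :=
  [set c : {dffun forall v : V, L v} |
    [forall u, forall v, e u v ==> (\val (c u) != \val (c v))]].

(* Main.v *)
(** Embed the colors in a field F and let f (x) be the product of x_u - x_v over
    the edges uv: a polynomial of degree nk/2 whose nonzeros on the grid of the
    lists are exactly the proper colorings.  The iterated divided difference
    over the grid is a weighted sum, with all weights nonzero, that annihilates
    every polynomial of degree less than n(k-1).  Let N > 0 be the number of
    nonzeros of f.  Multiplying f by N - 1 affine factors leaves one nonzero,
    on which that weighted sum does not vanish; hence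
    nk/2 + N - 1 >= n(k-1), that is N >= n(k/2 - 1) + 1. *)
Require Import Defs.
From mathcomp Require Import all_boot all_order all_algebra finmap.
From mathcomp Require Import zify lra.
Import Order.TTheory GRing.Theory Num.Theory.
Local Open Scope ring_scope.

Set Implicit Arguments.
Unset Strict Implicit.
Unset Printing Implicit Defensive.

(** Lets a grid sum of a product of one-coordinate functions split into one-dimensional sums. It is
    reduced to distributivity over tagged values by way of [fprod]. *)
Lemma bigA_distr_dffun (R : comNzSemiRingType) (I : finType) (T : I -> finType)
    (P : forall i, T i -> R) :
  \prod_i \sum_(t : T i) P i t =
  \sum_(x : {dffun forall i, T i}) \prod_i P i (x i).
Proof.
rewrite (reindex (@dffun_of_fprod I T)) /=; last first.
  exact/onW_bij/dffun_of_fprod_bij.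
pose Q i := [ffun t : T i => P i t].
under [RHS]eq_bigr => t _ do
  under eq_bigr => i _ do rewrite ffunE -[P i _](ffunE (P i)).
rewrite (big_fprod _ _ Q).
rewrite -(bigA_distr_big_dep (fun i => [in tagged_with T i])
  (fun i => untag 0 (Q i))).
apply: eq_bigr => i _; rewrite -(big_tag (fun i t => Q i t)).
by apply: eq_bigr => t _; rewrite ffunE.
Qed.

Section DividedDifference.
Variables (F : fieldType) (T : finType) (a : T -> F).
Hypothesis a_inj : injective a.

(** This is the leading coefficient of the Lagrange basis polynomial at the node [a t]. *)
Definition ddiff_weight (t : T) : F := (\prod_(s | s != t) (a t - a s))^-1.

Lemma ddiff_weight_neq0 t : ddiff_weight t != 0.
Proof.
rewrite invr_eq0; apply/prodf_neq0 => s st.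
by rewrite subr_eq0 (inj_eq a_inj) eq_sym.
Qed.

(* The sum is the top coefficient of the Lagrange interpolant of 'X^m. *)
Lemma ddiff_monomial m :
  (m < #|T|.-1)%N -> \sum_t ddiff_weight t * a t ^+ m = 0.
Proof.
move=> mT; pose l t := \prod_(s | s != t) ('X - (a s)%:P).
have size_l t : size (l t) = #|T|.-1.+1.
  rewrite /l -big_filter size_prod_XsubC size_filter.
  by rewrite -sum1_count sum1_card cardC1.
pose p := 'X^m - \sum_t (ddiff_weight t * a t ^+ m) *: l t.
have T_gt0 : (#|T|.-1.+1 = #|T|)%N by apply: prednK; lia.
(* [p] is ['X^m] minus its interpolant: its size is at most [#|T|], yet it vanishes at all [#|T|]
   nodes. *)
have p0 : p = 0.
  apply: (@roots_geq_poly_eq0 _ _ [seq a t | t <- enum T]).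
  - apply/allP => _ /mapP[t _ ->]; rewrite rootE /p hornerD hornerN hornerXn.
    rewrite horner_sum (bigD1 t) //= big1 => [|s st].
      rewrite addr0 hornerZ horner_prod mulrAC mulrC.
      under eq_bigr do rewrite hornerXsubC.
      by rewrite mulVf ?mulr1 ?subrr // -invr_eq0 ddiff_weight_neq0.
    rewrite hornerZ horner_prod (bigD1 t) 1?eq_sym //=.
    by rewrite hornerXsubC subrr mul0r mulr0.
  - by rewrite map_inj_uniq ?enum_uniq.
  - rewrite size_map -cardT -T_gt0 (leq_trans (size_polyD _ _)) // geq_max.
    rewrite size_polyN size_polyXn ltnS ltnW //=.
    apply: (leq_trans (size_sum _ _ _)); apply/bigmax_leqP => t _.
    by rewrite -(size_l t) size_scale_leq.
have := congr1 (fun q : {poly F} => q`_#|T|.-1) p0.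
rewrite coef0 coefB coefXn gtn_eqF // sub0r coef_sum => /eqP.
rewrite oppr_eq0 => /eqP sum0; rewrite -[RHS]sum0; apply: eq_bigr => t _.
rewrite coefZ -[in LHS](mulr1 (_ * _)); congr (_ * _).
have /monicP := monic_prod_XsubC (index_enum T) (fun s => s != t) a.
by rewrite lead_coefE size_l => <-.
Qed.

End DividedDifference.

Section Grid.
Variables (F : fieldType) (I : finType) (T : I -> finType).
Variable a : forall i, T i -> F.
Hypothesis a_inj : forall i, injective (@a i).
Local Notation grid := {dffun forall i, T i}.

Definition grid_weight (x : grid) : F := \prod_i ddiff_weight (@a i) (x i).

Lemma grid_weight_neq0 x : grid_weight x != 0.
Proof. by apply/prodf_neq0 => i _; apply: ddiff_weight_neq0. Qed.

(* Stands for "g is a polynomial function of degree at most d"; only the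
   vanishing of its divided differences, also after multiplication by
   monomials, is ever needed. *)
Definition grid_degree_le (d : nat) (g : grid -> F) : Prop :=
  forall m : I -> nat, (d + \sum_i m i < \sum_i #|T i|.-1)%N ->
  \sum_x grid_weight x * \prod_i a (x i) ^+ m i * g x = 0.

(** Some exponent [m i] must be below [#|T i|.-1]; the grid sum factors over the coordinates, and
    its factor at [i] is a vanishing divided difference. *)
Lemma grid_degree_le1 : grid_degree_le 0 (fun=> 1).
Proof.
move=> m; rewrite add0n => ltm.
have [i lti] : exists i, (m i < #|T i|.-1)%N.
  apply/existsP; apply: contraLR ltm; rewrite negb_exists => /forallP mT.
  by rewrite -leqNgt; apply: leq_sum => i _; rewrite leqNgt mT.
under eq_bigr do rewrite mulr1 -big_split.
rewrite -(bigA_distr_dffun (fun i t => ddiff_weight (@a i) t * a t ^+ m i)).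
by rewrite (bigD1 i) //= ddiff_monomial ?mul0r.
Qed.

Lemma grid_degree_leW d d' g :
  (d <= d')%N -> grid_degree_le d g -> grid_degree_le d' g.
Proof. by move=> dd' gd m md'; apply: gd; lia. Qed.

Lemma eq_grid_degree_le d g h :
  g =1 h -> grid_degree_le d g -> grid_degree_le d h.
Proof.
move=> gh gd m md; rewrite -[RHS](gd m md).
by apply: eq_bigr => x _; rewrite gh.
Qed.

Lemma grid_degree_leB d g h : grid_degree_le d g -> grid_degree_le d h ->
  grid_degree_le d (fun x => g x - h x).
Proof.
move=> gd hd m md; under eq_bigr do rewrite mulrBr.
by rewrite sumrB gd // hd // subrr.
Qed.

Lemma grid_degree_leZ d c g :
  grid_degree_le d g -> grid_degree_le d (fun x => c * g x).
Proof.
move=> gd m md; under eq_bigr do rewrite mulrCA.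
by rewrite -mulr_sumr gd // mulr0.
Qed.

(** The new factor is absorbed into the test monomial by raising its exponent at [i] by one. *)
Lemma grid_degree_le_mulX d i g :
  grid_degree_le d g -> grid_degree_le d.+1 (fun x => a (x i) * g x).
Proof.
move=> gd m md; have := gd (fun j => m j + (j == i))%N.
have delta1 : (\sum_j (j == i) = 1)%N.
  by rewrite (bigD1 i) //= eqxx big1 // => j /negPf->.
rewrite big_split /= delta1 => /(_ _) sum0; rewrite -[RHS]sum0; last first.
  by rewrite addn1 addnS.
apply: eq_bigr => x _; rewrite mulrA; congr (_ * _).
rewrite -mulrA; congr (_ * _).
under [RHS]eq_bigr do rewrite exprD.
rewrite big_split; congr (_ * _).
rewrite (bigD1 i) //= eqxx expr1 big1 ?mulr1 // => j ji.
by rewrite (negPf ji).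
Qed.

Lemma grid_degree_le_mulXsubC d i c g :
  grid_degree_le d g -> grid_degree_le d.+1 (fun x => (a (x i) - c) * g x).
Proof.
move=> gd; apply: eq_grid_degree_le (grid_degree_leB (grid_degree_le_mulX i gd)
  (grid_degree_leZ c (grid_degree_leW (leqnSn d) gd))) => x.
by rewrite mulrBl.
Qed.

Lemma grid_degree_le_mulXsubX d i j g :
  grid_degree_le d g ->
  grid_degree_le d.+1 (fun x => (a (x i) - a (x j)) * g x).
Proof.
move=> gd; apply: eq_grid_degree_le (grid_degree_leB (grid_degree_le_mulX i gd)
  (grid_degree_le_mulX j gd)) => x.
by rewrite mulrBl.
Qed.

Lemma grid_degree_le_prodXsubX (r : seq (I * I)) :
  grid_degree_le (size r) (fun x => \prod_(p <- r) (a (x p.1) - a (x p.2))).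
Proof.
elim: r => [|p r IHr] /=.
  by apply: eq_grid_degree_le grid_degree_le1 => x; rewrite big_nil.
apply: eq_grid_degree_le (grid_degree_le_mulXsubX p.1 p.2 IHr) => x.
by rewrite big_cons.
Qed.

(** Each [y] in [s] differs from [x0] in some coordinate [i]; the factor [a (x i) - a (y i)] kills
    [y], spares [x0] and costs one degree. *)
Lemma grid_degree_le_isolate d g x0 (s : seq grid) :
  grid_degree_le d g -> g x0 != 0 -> x0 \notin s ->
  exists h, [/\ grid_degree_le (d + size s) h, h x0 != 0 &
    forall x, (g x == 0) || (x \in s) -> h x = 0].
Proof.
move=> gd gx0; elim: s => [|y s IHs] /=.
  move=> _; exists g; split; rewrite ?addn0 // => x.
  by rewrite orbF => /eqP.
rewrite inE negb_or => /andP[x0y /IHs[h [hd hx0 h0]]].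
have [i neqi] : exists i, x0 i != y i.
  apply/existsP; apply: contra_neqT x0y; rewrite negb_exists => /forallP eqxy.
  by apply/ffunP => i; apply/eqP; rewrite -[_ == _]negbK.
exists (fun x : grid => (a (x i) - a (y i)) * h x); split.
- by rewrite addnS; apply: grid_degree_le_mulXsubC.
- by rewrite mulf_neq0 // subr_eq0 (inj_eq (@a_inj i)).
- move=> x; rewrite inE orbCA => /predU1P[-> | /h0 ->]; last by rewrite mulr0.
  by rewrite subrr mul0r.
Qed.

(** Killing every nonzero of [g] but [x0] leaves a function whose weighted sum is the single nonzero
    term at [x0], so its degree cannot be small. *)
Lemma card_grid_nonzeros d g x0 : grid_degree_le d g -> g x0 != 0 ->
  (\sum_i #|T i|.-1 < d + #|[set x | (g x != 0)%R]|)%N.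
Proof.
move=> gd gx0; set S := [set x | _].
have x0S : x0 \in S by rewrite inE.
have [|h [hd hx0 h0]] := @grid_degree_le_isolate d g x0 (enum (S :\ x0)) gd gx0.
  by rewrite mem_enum !inE eqxx.
rewrite ltnNge; apply/negP => leT.
(* Removing [x0] from [S] saves one factor, which makes the inequality strict; the zero exponents
   are those of the test monomial 1. *)
have : (d + size (enum (S :\ x0)) + \sum_(i : I) 0 < \sum_i #|T i|.-1)%N.
  rewrite big1 // addn0 -cardE.
  by move: leT; rewrite (cardsD1 x0 S) x0S add1n addnS.
move=> /(hd (fun=> 0%N))/eqP; apply/negP.
rewrite (bigD1 x0) //= [X in _ + X]big1 => [|x xx0].
  by rewrite addr0 big1 // mulr1 mulf_neq0 ?grid_weight_neq0.
rewrite h0 ?mulr0 // mem_enum !inE xx0.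
by case: eqP.
Qed.

End Grid.

(** Handshake count: ordering by [enum_rank] picks one orientation per edge, and these pairs with
    their reversals make up all ordered adjacent pairs. *)
Lemma card_edges (V : finType) (e : rel V) k :
  simple_graph e -> regular e k ->
  (#|[set p : V * V | e p.1 p.2 && (enum_rank p.1 < enum_rank p.2)]|.*2
    = #|V| * k)%N.
Proof.
move=> [esym eirr] ereg; set E := [set p | _].
pose E' := [set p : V * V | e p.1 p.2 && (enum_rank p.2 < enum_rank p.1)%N].
have cardE' : #|E'| = #|E|.
  have -> : E' = (fun p => (p.2, p.1)) @^-1: E.
    by apply/setP => -[u v]; rewrite !inE /= esym.
  rewrite on_card_preimset //; apply/onW_bij.
  by exists (fun p => (p.2, p.1)); case.
have disj : E :&: E' = set0.
  apply/setP => -[u v]; rewrite !inE /=.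
  by case: ltngtP; rewrite ?andbF.
rewrite -addnn -[in X in (_ + X)%N]cardE' -cardsUI disj cards0 addn0.
rewrite -sum1_card (eq_bigl (fun p => e p.1 p.2)) => [|[u v]]; last first.
  rewrite !inE /= -andb_orr -neq_ltn.
  case euv: (e u v) => //=.
  rewrite (inj_eq (inj_comp val_inj enum_rank_inj)).
  by apply: contraTneq euv => ->; rewrite eirr.
rewrite -(pair_big_dep predT (fun u v => e u v) (fun _ _ => 1%N)) /=.
rewrite -sum_nat_const; apply: eq_bigr => v _.
by rewrite -[RHS](ereg v) -sum1_card; apply: eq_bigl => u; rewrite inE.
Qed.

Theorem theorem5 (V : finType) (e : rel V) (n k : nat) (C : choiceType)
    (L : V -> {fset C})
    (hG : simple_graph e) (hn : #|V| = n) (hk : regular e k)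
    (hL : forall v : V, #|` L v| = k)
    (hex : exists c : {dffun forall v : V, L v}, c \in list_colorings e L) :
  n%:R * (k%:R / 4%:R - 1) + 1 <= #|list_colorings e L|%:R :> rat.
Proof.
case: hex => c0 c0P; have [esym eirr] := hG.
pose colors := flatten [seq enum_fset (L v) | v <- enum V].
(* One numbering serves all lists, so that [a] also compares colors at different vertices. *)
pose a v (t : L v) : rat := (index (val t) colors)%:R.
have mem_colors v (t : L v) : val t \in colors.
  by apply/flatten_mapP; exists v; rewrite ?mem_enum ?(valP t).
have a_eq u v (s : L u) (t : L v) : (a u s == a v t) = (val s == val t).
  rewrite eqr_nat; apply/eqP/eqP => [|-> //].
  exact: (index_inj (val s) (mem_colors u s) (mem_colors v t)).
have a_inj v : injective (a v).
  by move=> s t /eqP; rewrite a_eq => /eqP/val_inj.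
set E := [set p : V * V | e p.1 p.2 && (enum_rank p.1 < enum_rank p.2)%N].
pose g (x : {dffun forall v, L v}) :=
  \prod_(p <- enum E) (a _ (x p.1) - a _ (x p.2)).
have gP x : (g x != 0) = (x \in list_colorings e L).
  rewrite /g prodf_seq_neq0 inE; apply/allP/forallP => [xE u | xe p].
    apply/forallP => v; apply/implyP => euv; rewrite -a_eq.
    have [ltuv | ltvu | /val_inj/enum_rank_inj equv] :=
      ltngtP (enum_rank u) (enum_rank v).
    - have /= := xE (u, v).
      by rewrite mem_enum inE /= euv ltuv subr_eq0 => /(_ isT).
    - have /= := xE (v, u).
      by rewrite mem_enum inE /= -esym euv ltvu subr_eq0 eq_sym => /(_ isT).
    - by rewrite equv eirr in euv.
  rewrite mem_enum inE => /andP[ep _] /=.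
  by rewrite subr_eq0 a_eq (implyP (forallP (xe p.1) p.2)).
have := card_grid_nonzeros (x0 := c0) a_inj
  (grid_degree_le_prodXsubX a_inj (r := enum E)).
rewrite -/(g _) gP c0P => /(_ isT).
have -> : [set x | g x != 0] = list_colorings e L.
  by apply/setP => x; rewrite inE gP.
have := card_edges hG hk; rewrite -/E hn -cardE => cE.
under eq_bigr do rewrite -cardfE hL.
rewrite sum_nat_const cardT -cardE hn.
set N := #|list_colorings e L|; have N_gt0 : (0 < N)%N.
  by apply/card_gt0P; exists c0.
move=> leN.
(* For [k = 0] the truncated [k.-1] is 0 instead of -1, so this case uses only [N_gt0]. *)
have [k0 | k_gt0] := posnP k.
  rewrite k0 mul0r sub0r mulrN1.
  have := ler0n rat n; have : 1 <= N%:R :> rat by rewrite ler1n.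
  lra.
have leN' : (n * k + 2 <= 2 * N + 2 * n)%N.
  have nkE : (n * k = n + n * k.-1)%N by rewrite -mulnS prednK.
  move: cE leN; rewrite nkE -addnn; lia.
move: leN'; rewrite -(ler_nat rat) !natrD !natrM.
(* As [n * k] is nonnegative, the bound obtained with [k / 2] implies the one with [k / 4]. *)
have := mulr_ge0 (ler0n rat n) (ler0n rat k).
lra.
Qed.
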